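(* Let $A$ be a member of a congruence-modular variety $\mathcal V$, with modular commutator $[\cdot,\cdot]_A$ on $\mathrm{Con}(A)$. Assume that $A$ is semiprime, that $\{\theta\in\mathrm{Con}(A): \rho_A(\theta)=\nabla_A\}=\{\nabla_A\}$, and that $[\alpha,\nabla_A]_A=\alpha$ for all $\alpha\in\mathrm{Con}(A)$ (in particular, these hypotheses hold if $A$ is semiprime and $\mathcal V$ is semi-degenerate, or if $\mathcal V$ is congruence-distributive and $\nabla_A$ is a compact congruence; in particular if $\mathcal V$ is congruence-distributive and semi-degenerate). Put $L=\mathrm{Con}(A)$. For $s$ being either a cardinality $\kappa$, or the symbol $<\infty$, or the symbol $\mathrm{all}$, call a set $s$-small if, respectively, it has cardinality at most $\kappa$, it is finite, or it is arbitrary, and consider: $(1)_s$: for every $s$-small $U\subseteq L$ there is $e\in\mathcal B(L)$ with $\mathrm{Ann}_L(U)=(e]_L$; $(2)_s$: $L$ is a Stone lattice and $\mathcal B(L)$ is an $s$-complete Boolean sublattice of $L$; $(3)_s$: $\mathrm{P2Ann}(L)$ is an $s$-complete Boolean sublattice of $\mathrm{Id}(L)$ such that $a\mapsto \mathrm{Ann}_L(\mathrm{Ann}_L(a))$ is a lattice morphism from $L$ to $\mathrm{P2Ann}(L)$; $(4)_s$: $\mathrm{Ann}_L(a\wedge b)=(\mathrm{Ann}_L(a)\cup\mathrm{Ann}_L(b)]_L$ for all $a,b\in L$, and $\mathrm{Ann}_L(\mathrm{Ann}_L(U))\in\mathrm{PAnn}(L)$ for every $s$-small $U\subseteq L$;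 $(5)_s$: $(\mathrm{Ann}_L(U)\cup\mathrm{Ann}_L(\mathrm{Ann}_L(U))]_L=L$ for every $s$-small $U\subseteq L$; $(iv)$: $\mathrm{Ann}_L(a\wedge b)=(\mathrm{Ann}_L(a)\cup\mathrm{Ann}_L(b)]_L$ for all $a,b\in L$. Then for any $i,j\in\{1,\dots,5\}$ and any nonzero cardinalities $\kappa,\mu$, the conditions $(iv)$, $(i)_\kappa$ and $(j)_\mu$ are equivalent, and thus each of them is equivalent to $(i)_{<\infty}$ and to $(i)_{\mathrm{all}}$. In particular the following are equivalent: $L$ is Stone; $L$ is strongly Stone and $\mathcal B(L)$ is a complete Boolean sublattice of $L$; $(3)_{<\infty}$; $(3)_{\mathrm{all}}$; $(iv)$; $(\mathrm{Ann}_L(a)\cup \mathrm{Ann}_L(\mathrm{Ann}_L(a))]_L=L$ for all $a\in L$.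
   Context: $\mathrm{Con}(A)$ is the lattice of congruences of $A$, with least element $\Delta_A$ and greatest element $\nabla_A$. For $A$ in a congruence-modular variety, $[\alpha,\beta]_A$ is the (Freese–McKenzie/Gumm) modular commutator: the least congruence $\delta$ of $A$ such that $\alpha$ centralizes $\beta$ modulo $\delta$ (term condition); it is commutative, below the intersection, and distributes over arbitrary joins. A prime congruence of $A$ is a $\phi\in\mathrm{Con}(A)\setminus\{\nabla_A\}$ such that $[\alpha,\beta]_A\subseteq\phi$ implies $\alpha\subseteq\phi$ or $\beta\subseteq\phi$. $\rho_A(\alpha)$ is the intersection of all prime congruences containing $\alpha$ (equal to $\nabla_A$ if there are none). $A$ is semiprime if $\rho_A(\Delta_A)=\Delta_A$. A variety is semi-degenerate if no nontrivial (more than one-element) algebra in it has a trivial (one-element) subalgebra. For a bounded lattice $L$: $\mathcal B(L)$ is the set of complemented elements. $(U]_L$ is the ideal generated by $U$, $(a]_L=(\{a\}]_L$, $\mathrm{Id}(L)$ is the lattice of ideals. $\mathrm{Ann}_L(a)=\{x\in L: x\wedge a=0\}$, $\mathrm{Ann}_L(U)=\bigcap_{u\in U}\mathrm{Ann}_L(u)$, $\mathrm{PAnn}(L)=\{\mathrm{Ann}_L(a): a\in L\}$, $\mathrm{P2Ann}(L)=\{\mathrm{Ann}_L(\mathrm{Ann}_L(a)): a\in L\}$. $L$ is Stone (strongly Stone) if for each $a\in L$ (each $U\subseteq L$) the annihilator equals $(e]_L$ for some $e\in\mathcal B(L)$. A Boolean sublattice is a bounded sublattice which is a Boolean algebra;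 it is $s$-complete if each of its $s$-small subsets has a supremum and an infimum computed in that Boolean algebra itself. *)

(* Defs.v *)
From HB Require Import structures.
From mathcomp Require Import all_boot all_order.
From mathcomp Require Import boolp classical_sets functions cardinality.

Set Implicit Arguments.
Unset Strict Implicit.
Unset Printing Implicit Defensive.

Import Order.TTheory.

Local Open Scope classical_set_scope.
Local Open Scope card_scope.

Record signature := Signature { symb : Type; arity : symb -> nat }.

Record algebra (S : signature) := Algebra {
  carrier :> Type;
  op : forall f : symb S, ('I_(arity f) -> carrier) -> carrier;
  carrier_inhabited : inhabited carrier
}.
Arguments op {S} a f _.

Inductive term (S : signature) (X : Type) :=
| Var of X
| App (f : symb S) of ('I_(arity f) -> term S X).
Arguments Var {S X}.
Arguments App {S X} f _.

Fixpoint eval (S : signature) (A : algebra S) (X : Type) (env : X -> A)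
    (t : term S X) : A :=
  match t with
  | Var x => env x
  | App f args => op A f (fun i => eval env (args i))
  end.

(* A variety (equational class) is given by a set of identities. *)
Definition variety (S : signature) := set (term S nat * term S nat).

Definition in_variety (S : signature) (V : variety S) (A : algebra S) : Prop :=
  forall e, V e -> forall env : nat -> A, eval env e.1 = eval env e.2.

Definition subuniverse (S : signature) (A : algebra S) (B : set A) : Prop :=
  forall (f : symb S) (x : 'I_(arity f) -> A),
    (forall i, B (x i)) -> B (op A f x).

Definition nontrivial (T : Type) : Prop := exists x y : T, x <> y.

Definition semi_degenerate (S : signature) (V : variety S) : Prop :=
  forall A : algebra S, in_variety V A -> nontrivial A ->
    ~ exists x : A, subuniverse [set x].

Section Congruences.
Variables (S : signature) (A : algebra S).

Record con := Con {
  con_rel :> A -> A -> Prop;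
  con_refl : forall x, con_rel x x;
  con_sym : forall x y, con_rel x y -> con_rel y x;
  con_trans : forall x y z, con_rel x y -> con_rel y z -> con_rel x z;
  con_op : forall (f : symb S) (x y : 'I_(arity f) -> A),
    (forall i, con_rel (x i) (y i)) -> con_rel (op A f x) (op A f y)
}.

Lemma con_ext (a b : con) : (forall x y, a x y <-> b x y) -> a = b.
Proof.
case: a => a a1 a2 a3 a4; case: b => b b1 b2 b3 b4 /= ab.
have E : a = b by apply/funext => x; apply/funext => y; apply/propext.
by subst b; congr Con; exact: Prop_irrelevance.
Qed.

HB.instance Definition _ := gen_eqMixin con.
HB.instance Definition _ := gen_choiceMixin con.

Definition con_le (a b : con) : bool := `[< forall x y, a x y -> b x y >].

Lemma con_le_refl : reflexive con_le.
Proof. by move=> a; apply/asboolP. Qed.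

Lemma con_le_anti : antisymmetric con_le.
Proof.
move=> a b /andP[/asboolP ab /asboolP ba].
by apply: con_ext => x y; split; [exact: ab|exact: ba].
Qed.

Lemma con_le_trans : transitive con_le.
Proof.
move=> b a c /asboolP ab /asboolP bc.
by apply/asboolP => x y /ab /bc.
Qed.

Fact con_display : Order.disp_t. Proof. exact: Order.Disp tt tt. Qed.

HB.instance Definition _ := Order.Le_isPOrder.Build con_display con
  con_le_refl con_le_anti con_le_trans.

Lemma con_leP (a b : con) : reflect (forall x y, a x y -> b x y) (a <= b)%O.
Proof. exact: asboolP. Qed.

(* The intersection of the empty family is the total congruence. *)
Program Definition con_inf (C : set con) : con :=
  @Con (fun x y => forall a, C a -> a x y) _ _ _ _.
Next Obligation. exact: con_refl. Qed.
Next Obligation. by apply: con_sym; auto. Qed.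
Next Obligation. by apply: (@con_trans _ _ y); auto. Qed.
Next Obligation. by apply: con_op => i; auto. Qed.

Definition con_sup (C : set con) : con := con_inf (ubound C).

Definition con_meet (a b : con) : con := con_inf [set a; b].
Definition con_join (a b : con) : con := con_sup [set a; b].

Lemma con_infP (C : set con) (a : con) :
  (a <= con_inf C)%O <-> lbound C a.
Proof.
split=> [/con_leP h b Cb|h].
  by apply/con_leP => x y /h; exact.
by apply/con_leP => x y axy b /h /con_leP; exact.
Qed.

Lemma con_supP (C : set con) (a : con) :
  (con_sup C <= a)%O <-> ubound C a.
Proof.
split=> [/con_leP h b Cb|h].
  by apply/con_leP => x y bxy; apply: h => c /(_ _ Cb) /con_leP; exact.
by apply/con_leP => x y; exact.
Qed.

Lemma con_lexI (a b c : con) :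
  (a <= con_meet b c)%O = (a <= b)%O && (a <= c)%O.
Proof.
apply/idP/andP => [/con_infP h|[ab ac]].
  by split; apply: h; [left|right].
by apply/con_infP => d [->|->].
Qed.

Lemma con_leUx (a b c : con) :
  (con_join a b <= c)%O = (a <= c)%O && (b <= c)%O.
Proof.
apply/idP/andP => [/con_supP h|[ac bc]].
  by split; apply: h; [left|right].
by apply/con_supP => d [->|->].
Qed.

HB.instance Definition _ := Order.POrder_MeetJoin_isLattice.Build con_display
  con con_lexI con_leUx.

Definition con_bot : con :=
  @Con eq (@erefl A) (fun x y e => esym e) (fun x y z => @etrans A x y z)
    (fun f x y h => f_equal (op A f) (funext h)).

Definition con_top : con :=
  @Con (fun _ _ => True) (fun=> I) (fun _ _ _ => I) (fun _ _ _ _ _ => I)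
    (fun _ _ _ _ => I).

Lemma con_le0x (a : con) : (con_bot <= a)%O.
Proof. by apply/con_leP => x y ->; exact: con_refl. Qed.

Lemma con_lex1 (a : con) : (a <= con_top)%O.
Proof. exact/con_leP. Qed.

HB.instance Definition _ := Order.hasBottom.Build con_display con con_le0x.
HB.instance Definition _ := Order.hasTop.Build con_display con con_lex1.

End Congruences.

Section Commutator.
Variables (S : signature) (A : algebra S).

Definition sum_env (X Y : Type) (f : X -> A) (g : Y -> A) (z : X + Y) : A :=
  match z with inl x => f x | inr y => g y end.

Definition centralizes (alpha beta delta : con A) : Prop :=
  forall (m n : nat) (t : term S ('I_m + 'I_n))
    (a b : 'I_m -> A) (u v : 'I_n -> A),
    (forall i, alpha (a i) (b i)) -> (forall j, beta (u j) (v j)) ->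
    delta (eval (sum_env a u) t) (eval (sum_env a v) t) ->
    delta (eval (sum_env b u) t) (eval (sum_env b v) t).

Definition commutator (alpha beta : con A) : con A :=
  con_inf (centralizes alpha beta).

(* The intersection defining the commutator belongs to the family, so it is
   the least congruence modulo which alpha centralizes beta. *)
Lemma commutator_least (alpha beta : con A) :
  centralizes alpha beta (commutator alpha beta) /\
  lbound (centralizes alpha beta) (commutator alpha beta).
Proof.
split; last exact/con_infP.
move=> m n t a b u v ab uv h d Cd.
by apply: (Cd _ _ _ _ _ _ _ ab uv); exact: h.
Qed.

Definition prime_congruence (phi : con A) : Prop :=
  phi <> \top%O /\
  forall alpha beta : con A, (commutator alpha beta <= phi)%O ->
    (alpha <= phi)%O \/ (beta <= phi)%O.

Definition rho (alpha : con A) : con A :=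
  con_inf [set phi | prime_congruence phi /\ (alpha <= phi)%O].

Definition semiprime : Prop := rho \bot%O = \bot%O.

Definition compact_congruence (theta : con A) : Prop :=
  forall C : set (con A), (theta <= con_sup C)%O ->
    exists F : set (con A),
      [/\ finite_set F, F `<=` C & (theta <= con_sup F)%O].

End Commutator.
Arguments semiprime {S} A.

Section LatticeNotions.
Variables (d : Order.disp_t) (L : tbLatticeType d).

Definition modular_lattice : Prop :=
  forall x y z : L, (x <= z)%O ->
    Order.join x (Order.meet y z) = Order.meet (Order.join x y) z.

Definition distributive_on (B : set L) : Prop :=
  forall x y z : L, B x -> B y -> B z ->
    Order.meet x (Order.join y z) =
    Order.join (Order.meet x y) (Order.meet x z).

Definition distributive_lattice : Prop := distributive_on [set: L].

Definition complements (x y : L) : Prop :=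
  Order.meet x y = \bot%O /\ Order.join x y = \top%O.

Definition complemented : set L := [set x | exists y, complements x y].

Definition bounded_sublattice (B : set L) : Prop :=
  [/\ B \bot%O, B \top%O,
      forall x y, B x -> B y -> B (Order.meet x y)
    & forall x y, B x -> B y -> B (Order.join x y)].

Definition boolean_sublattice (B : set L) : Prop :=
  [/\ bounded_sublattice B, distributive_on B
    & forall x, B x -> exists2 y, B y & complements x y].

Definition is_ideal (J : set L) : Prop :=
  [/\ J \bot%O, forall x y, J x -> J y -> J (Order.join x y)
    & forall x y, (x <= y)%O -> J y -> J x].

Definition ideal_gen (U : set L) : set L := smallest is_ideal U.

Definition principal_ideal (a : L) : set L := ideal_gen [set a].

Definition Ann (a : L) : set L := [set x | Order.meet x a = \bot%O].

Definition AnnS (U : set L) : set L := \bigcap_(u in U) Ann u.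

Definition PAnn : set (set L) := range Ann.

Definition P2Ann : set (set L) := [set AnnS (Ann a) | a in [set: L]].

Definition stone : Prop :=
  forall a : L, exists2 e, complemented e & Ann a = principal_ideal e.

Definition strongly_stone : Prop :=
  forall U : set L, exists2 e, complemented e & AnnS U = principal_ideal e.

End LatticeNotions.
Arguments modular_lattice {d} L.
Arguments distributive_lattice {d} L.
Arguments complemented {d} L.
Arguments PAnn {d} L.
Arguments P2Ann {d} L.
Arguments stone {d} L.
Arguments strongly_stone {d} L.

Section IdealLattice.
Variables (d : Order.disp_t) (L : tbLatticeType d).

Record ideal := Ideal { ideal_set :> set L; idealP : is_ideal ideal_set }.

Lemma ideal_ext (I J : ideal) : (I : set L) = J -> I = J.
Proof.
case: I J => [I hI] [J hJ] /= E; subst J; congr Ideal; exact: Prop_irrelevance.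
Qed.

HB.instance Definition _ := gen_eqMixin ideal.
HB.instance Definition _ := gen_choiceMixin ideal.

Definition ideal_le (I J : ideal) : bool := `[< I `<=` J >].

Lemma ideal_le_refl : reflexive ideal_le.
Proof. by move=> I; apply/asboolP. Qed.

Lemma ideal_le_anti : antisymmetric ideal_le.
Proof.
move=> I J /andP[/asboolP IJ /asboolP JI].
by apply: ideal_ext; apply/seteqP.
Qed.

Lemma ideal_le_trans : transitive ideal_le.
Proof.
by move=> J I K /asboolP IJ /asboolP JK; apply/asboolP => x /IJ /JK.
Qed.

Fact ideal_display : Order.disp_t. Proof. exact: Order.Disp tt tt. Qed.

HB.instance Definition _ := Order.Le_isPOrder.Build ideal_display ideal
  ideal_le_refl ideal_le_anti ideal_le_trans.

Lemma ideal_leP (I J : ideal) : reflect (I `<=` J) (I <= J)%O.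
Proof. exact: asboolP. Qed.

Lemma is_ideal_setI (I J : ideal) : is_ideal (I `&` J).
Proof.
case: (idealP I) (idealP J) => [I0 IU Il] [J0 JU Jl]; split=> //.
- by move=> x y [Ix Jx] [Iy Jy]; split; [exact: IU|exact: JU].
- by move=> x y xy [Iy Jy]; split; [exact: Il xy _|exact: Jl xy _].
Qed.

Lemma is_ideal_gen (U : set L) : is_ideal (ideal_gen U).
Proof.
split=> [J [[] //]|x y hx hy J hJ|x y xy hy J hJ].
- by case: (hJ) => -[_ JU _] _; apply: JU; [exact: hx|exact: hy].
- by case: (hJ) => -[_ _ Jl] _; apply: (Jl _ _ xy); exact: hy.
Qed.

Definition ideal_meet (I J : ideal) : ideal := Ideal (is_ideal_setI I J).
Definition ideal_join (I J : ideal) : ideal :=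
  Ideal (is_ideal_gen (I `|` J)).

Lemma ideal_lexI (I J K : ideal) :
  (I <= ideal_meet J K)%O = (I <= J)%O && (I <= K)%O.
Proof.
apply/ideal_leP/andP => [h|[/ideal_leP IJ /ideal_leP IK]].
  by split; apply/ideal_leP => x /h [].
by move=> x Ix; split; [exact: IJ|exact: IK].
Qed.

Lemma ideal_leUx (I J K : ideal) :
  (ideal_join I J <= K)%O = (I <= K)%O && (J <= K)%O.
Proof.
apply/ideal_leP/andP => [h|[/ideal_leP IK /ideal_leP JK]].
  by split; apply/ideal_leP => x xI; apply: h => M [_]; apply; [left|right].
by move=> x; apply; split; [exact: idealP|move=> y [/IK|/JK]].
Qed.

HB.instance Definition _ := Order.POrder_MeetJoin_isLattice.Build ideal_display
  ideal ideal_lexI ideal_leUx.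

Lemma is_ideal_bot : is_ideal [set \bot%O : L].
Proof.
split=> [//|x y -> ->|x y xy y0]; first by rewrite /= joinxx.
by move: xy; rewrite y0 lex0 => /eqP.
Qed.

Lemma is_ideal_top : is_ideal [set: L].
Proof. by []. Qed.

Definition ideal_bot : ideal := Ideal is_ideal_bot.
Definition ideal_top : ideal := Ideal is_ideal_top.

Lemma ideal_le0x (I : ideal) : (ideal_bot <= I)%O.
Proof. by apply/ideal_leP => x ->; case: (idealP I). Qed.

Lemma ideal_lex1 (I : ideal) : (I <= ideal_top)%O.
Proof. exact/ideal_leP. Qed.

HB.instance Definition _ := Order.hasBottom.Build ideal_display ideal ideal_le0x.
HB.instance Definition _ := Order.hasTop.Build ideal_display ideal ideal_lex1.

End IdealLattice.
Arguments ideal {d} L.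

(* A cardinality is represented by a type having it. *)
Variant smallness := AtMost of Type | SFinite | SAll.

Definition small (s : smallness) (T : Type) (U : set T) : Prop :=
  match s with
  | AtMost K => U #<= [set: K]
  | SFinite => finite_set U
  | SAll => True
  end.

Section Conditions.
Variables (d : Order.disp_t) (L : tbLatticeType d).

(* Suprema and infima are taken in the poset B, not in the ambient lattice. *)
Definition has_sup_in (B U : set L) : Prop :=
  exists x, (B `&` ubound U) x /\ lbound (B `&` ubound U) x.

Definition has_inf_in (B U : set L) : Prop :=
  exists x, (B `&` lbound U) x /\ ubound (B `&` lbound U) x.

Definition complete_boolean_sublattice (s : smallness) (B : set L) : Prop :=
  boolean_sublattice B /\
  forall U : set L, U `<=` B -> small s U -> has_sup_in B U /\ has_inf_in B U.

End Conditions.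

Section FiveConditions.
Variables (d : Order.disp_t) (L : tbLatticeType d).

Definition cond1 (s : smallness) : Prop :=
  forall U : set L, small s U ->
    exists2 e, complemented L e & AnnS U = principal_ideal e.

Definition cond2 (s : smallness) : Prop :=
  stone L /\ complete_boolean_sublattice s (complemented L).

(* The existence of f with these values says that every double annihilator of
   an element is an ideal, that is, P2Ann L is a subset of Id(L). *)
Definition cond3 (s : smallness) : Prop :=
  exists f : L -> ideal L,
    [/\ forall a, f a = AnnS (Ann a) :> set L,
        complete_boolean_sublattice s [set I : ideal L | P2Ann L I],
        Order.meet_morphism f & Order.join_morphism f].

Definition cond_iv : Prop :=
  forall a b : L, Ann (Order.meet a b) = ideal_gen (Ann a `|` Ann b).

Definition cond4 (s : smallness) : Prop :=
  cond_iv /\ forall U : set L, small s U -> PAnn L (AnnS (AnnS U)).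

Definition cond5 (s : smallness) : Prop :=
  forall U : set L, small s U ->
    ideal_gen (AnnS U `|` AnnS (AnnS U)) = [set: L].

Variant cond_index := I1 | I2 | I3 | I4 | I5.

Definition cond (i : cond_index) : smallness -> Prop :=
  match i with
  | I1 => cond1 | I2 => cond2 | I3 => cond3 | I4 => cond4 | I5 => cond5
  end.

End FiveConditions.
Arguments cond1 {d} L s.
Arguments cond2 {d} L s.
Arguments cond3 {d} L s.
Arguments cond_iv {d} L.
Arguments cond4 {d} L s.
Arguments cond5 {d} L s.
Arguments cond {d} L i s.

Definition congruence_modular (S : signature) (V : variety S) : Prop :=
  forall A : algebra S, in_variety V A -> modular_lattice (con A).

Definition congruence_distributive (S : signature) (V : variety S) : Prop :=
  forall A : algebra S, in_variety V A -> distributive_lattice (con A).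

Definition standing_hypotheses (S : signature) (A : algebra S) : Prop :=
  [/\ semiprime A,
      [set theta : con A | rho theta = \top%O] = [set \top%O]
    & forall alpha : con A, commutator alpha \top%O = alpha].

(* Main.v *)
(* For a set D, let syn D be the largest congruence saturating D. With D the
   set of delta-related pairs in the subalgebra beta of A x A, alpha
   centralizes beta modulo delta iff syn D identifies (a,a) with (b,b) whenever
   a alpha b; hence the commutator is completely additive on the left.
   Modularity, used only on the algebra of 4-ary term functions of A, gives
   Day's criterion, from which centrality is symmetric and monotone in its
   modulus (Freese-McKenzie). In a distributive variety the commutator is the
   intersection. In a semi-degenerate one the quotient of alpha <= A x A by
   syn D shows [alpha, top] = alpha, and a reduced power of A along a chain
   shows that proper congruences are closed under unions of chains, so that
   each of them lies in a maximal, hence prime, congruence.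

   By semiprimeness x meets a trivially iff [x,a] is trivial, so additivity
   gives L = Con(A) a pseudocomplement a* and Ann(U) = Ann(sup U): smallness
   is irrelevant and every condition reduces to a* v a** = 1 for all a. For
   the latter to imply (a ^ b)* <= a* v b*, split
   x = [x,1] = [x,a*] v [x,a**], and [x,a**] likewise along b. *)
Require Import Defs.
From mathcomp Require Import all_boot all_order.
From mathcomp Require Import boolp classical_sets functions cardinality.

Set Implicit Arguments.
Unset Strict Implicit.
Unset Printing Implicit Defensive.

Import Order.TTheory.

Local Open Scope classical_set_scope.

(** * Homomorphisms, quotients, powers and syntactic congruences *)

Section Algebras.
Variable S : signature.

Definition is_hom (A B : algebra S) (h : A -> B) : Prop :=
  forall (f : symb S) (x : 'I_(arity f) -> A),
    h (op A f x) = op B f (fun i => h (x i)).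

Lemma hom_eval (A B : algebra S) (h : A -> B) (X : Type) (env : X -> A)
    (t : term S X) :
  is_hom h -> h (eval env t) = eval (fun x => h (env x)) t.
Proof.
move=> hh; elim: t => //= f args IH; rewrite hh; congr op.
by apply/funext => i; exact: IH.
Qed.

Lemma con_eval (A : algebra S) (theta : con A) (X : Type) (e e' : X -> A)
    (t : term S X) :
  (forall x, theta (e x) (e' x)) -> theta (eval e t) (eval e' t).
Proof. by move=> ee'; elim: t => //= f args IH; exact: con_op. Qed.

Fixpoint subst (X Y : Type) (s : X -> term S Y) (t : term S X) : term S Y :=
  match t with
  | Var x => s x
  | App f args => App f (fun i => subst s (args i))
  end.

Lemma eval_subst (A : algebra S) (X Y : Type) (s : X -> term S Y)
    (env : Y -> A) (t : term S X) :
  eval env (subst s t) = eval (fun x => eval env (s x)) t.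
Proof.
by elim: t => //= f args IH; congr op; apply/funext => i; exact: IH.
Qed.

Program Definition preim_con (A B : algebra S) (h : A -> B) (hh : is_hom h)
    (theta : con B) : con A :=
  @Con _ _ (fun x y => theta (h x) (h y)) _ _ _ _.
Next Obligation. exact: con_refl. Qed.
Next Obligation. exact: con_sym. Qed.
Next Obligation. by apply: con_trans; eassumption. Qed.
Next Obligation. by rewrite !hh; exact: con_op. Qed.

(** Homomorphisms into [A] separating points embed [B] into a power of [A], and identities are
    inherited along such an embedding. *)
Lemma in_variety_separated (V : variety S) (A B : algebra S) :
  in_variety V A ->
  (forall x y : B, (forall h : B -> A, is_hom h -> h x = h y) -> x = y) ->
  in_variety V B.
Proof.
move=> hA sep e Ve env; apply: sep => h hh.
by rewrite !(hom_eval _ _ hh); exact: hA.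
Qed.

Lemma in_variety_image (V : variety S) (A B : algebra S) (h : A -> B) :
  is_hom h -> (forall y, exists x, h x = y) ->
  in_variety V A -> in_variety V B.
Proof.
move=> hh /choice[g hg] hA e Ve env.
have -> : env = fun n => h (g (env n)) by apply/funext => n; rewrite hg.
by rewrite -!(hom_eval _ _ hh) hA.
Qed.

(** Classes are encoded as the predicates [theta x], and operations are computed on chosen
    representatives [r c]. *)
Lemma quotient_algebra (A : algebra S) (theta : con A) :
  exists (B : algebra S) (h : A -> B),
    [/\ is_hom h, forall y, exists x, h x = y
      & forall x y, h x = h y <-> theta x y].
Proof.
pose T := {P : set A | exists x, P = theta x}.
pose cls x : T := exist _ (theta x : set A) (ex_intro _ x erefl).
have clsP x y : cls x = cls y <-> theta x y.
  split=> [/(congr1 sval) /= E|xy]; first by rewrite E; exact: con_refl.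
  apply: eq_exist; apply/funext => z /=; apply/propext; split.
    by apply: con_trans; exact: con_sym.
  exact: con_trans.
have /choice[r rP] (c : T) : exists x, cls x = c.
  by case: c => P [x Px]; exists x; apply: eq_exist.
have [x0] := carrier_inhabited A.
exists (@Algebra S T (fun f c => cls (op A f (fun i => r (c i))))
  (inhabits (cls x0))), cls; split=> //.
- by move=> f x /=; apply/clsP; apply: con_op => i; apply/clsP; rewrite rP.
- by move=> c; exists (r c).
Qed.

Definition power (A : algebra S) (I : Type) : algebra S :=
  @Algebra S (I -> A) (fun f x i => op A f (fun j => x j i))
    (let: inhabits a := carrier_inhabited A in inhabits (fun=> a)).

Lemma in_variety_power (V : variety S) (A : algebra S) (I : Type) :
  in_variety V A -> in_variety V (power A I).
Proof.
move=> hA; apply: (in_variety_separated hA) => x y xy.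
by apply/funext => i; exact: (xy (fun z : power A I => z i)).
Qed.

Definition update (A : algebra S) (n : nat) (w : 'I_n -> A) (i : 'I_n) (x : A)
  : 'I_n -> A := fun j => if j == i then x else w j.

(** Arguments are exchanged one at a time: [z k] below takes its first [k] coordinates from [y] and
    the others from [x]. *)
Lemma compatible_coordinatewise (A : algebra S) (R : A -> A -> Prop) :
  (forall x, R x x) -> (forall x y z, R x y -> R y z -> R x z) ->
  (forall (f : symb S) w i x y, R x y ->
     R (op A f (update w i x)) (op A f (update w i y))) ->
  forall (f : symb S) (x y : 'I_(arity f) -> A),
    (forall i, R (x i) (y i)) -> R (op A f x) (op A f y).
Proof.
move=> Rr Rt Ru f x y xy.
pose z k (j : 'I_(arity f)) := if j < k then y j else x j.
suff H k : R (op A f x) (op A f (z k)).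
  have -> : y = z (arity f) by apply/funext => j; rewrite /z ltn_ord.
  exact: H.
elim: k => [|k IH]; first exact: Rr.
apply: (Rt _ _ _ IH); have [kn|nk] := ltnP k (arity f); last first.
  suff -> : z k.+1 = z k by exact: Rr.
  apply/funext => j; rewrite /z (leq_trans (ltn_ord j) nk).
  by rewrite (leq_trans (ltn_ord j) (leqW nk)).
pose i := Ordinal kn.
have -> : z k = update (z k) i (x i).
  by apply/funext => j; rewrite /update; case: eqP => // ->; rewrite /z ltnn.
have -> : z k.+1 = update (z k) i (y i).
  apply/funext => j; rewrite /update; case: eqP => [->|ji].
    by rewrite /z ltnSn.
  by rewrite /z ltnS leq_eqVlt; case: eqP => // jk; case: ji; exact: val_inj.
exact: Ru.
Qed.

Section SyntacticCongruence.
Variables (A : algebra S) (D : set A).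

(** A Myhill-Nerode relation whose contexts are the unary polynomials of [A]: [ord0] is the hole and
    [c] lists the parameters. *)
Definition syn_rel (x y : A) : Prop :=
  forall (n : nat) (t : term S ('I_1 + 'I_n)) (c : 'I_n -> A),
    D (eval (sum_env (fun=> x) c) t) <-> D (eval (sum_env (fun=> y) c) t).

Lemma syn_op (f : symb S) (x y : 'I_(arity f) -> A) :
  (forall i, syn_rel (x i) (y i)) -> syn_rel (op A f x) (op A f y).
Proof.
move: f x y; apply: compatible_coordinatewise => // [x y z xy yz n t c|].
  by rewrite xy.
move=> f w i x y xy n t c.
(* Plugging [f] with its hole at [i] into the context [t] gives another context; the entries of [w]
   become additional parameters. *)
pose s (z : 'I_1 + 'I_n) : term S ('I_1 + 'I_(n + arity f)) :=
  match z with
  | inl _ => App f (fun j => if j == i then Var (inl ord0)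
                             else Var (inr (rshift n j)))
  | inr l => Var (inr (lshift (arity f) l))
  end.
pose c' (l : 'I_(n + arity f)) :=
  match fintype.split l with inl l' => c l' | inr j => w j end.
have E z : eval (sum_env (fun=> op A f (update w i z)) c) t
    = eval (sum_env (fun=> z) c') (subst s t).
  rewrite eval_subst; congr eval; apply/funext => -[k|l] /=.
    congr op; apply/funext => j; rewrite /update; case: eqP => //= _.
    by rewrite /c' (unsplitK (inr j)).
  by rewrite /c' (unsplitK (inl l)).
by rewrite !E.
Qed.

(* The largest congruence for which D is a union of classes. *)
Definition syn : con A :=
  @Con _ _ syn_rel (fun x n t c => iff_refl _)
    (fun x y xy n t c => iff_sym (xy n t c))
    (fun x y z xy yz n t c => iff_trans (xy n t c) (yz n t c)) syn_op.

Lemma syn_saturates (x y : A) : syn x y -> D x -> D y.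
Proof.
by move=> /(_ 0%N (Var (inl ord0)) (fun=> x)) [/= h _] Dx; exact: h.
Qed.

Lemma le_syn (theta : con A) :
  (forall x y, theta x y -> D x -> D y) -> (theta <= syn)%O.
Proof.
move=> sat; apply/con_leP => x y xy n t c.
have txy : theta (eval (sum_env (fun=> x) c) t) (eval (sum_env (fun=> y) c) t).
  by apply: con_eval => -[i|j] //=; exact: con_refl.
by split; apply: sat => //; exact: con_sym.
Qed.

End SyntacticCongruence.

End Algebras.
Lemma con_meetE (S : signature) (A : algebra S) (a b : con A) (x y : A) :
  Order.meet a b x y <-> a x y /\ b x y.
Proof.
change (con_meet a b x y <-> a x y /\ b x y).
split=> [ab|[axy bxy]]; last by move=> c [->|->].
by split; [apply: (ab a); left|apply: (ab b); right].
Qed.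

(** * A congruence as a subalgebra of the square, and the centralizer *)

Section PairAlgebra.
Variables (S : signature) (A : algebra S) (beta : con A).

Definition pair_alg : algebra S :=
  @Algebra S {p : A * A | beta p.1 p.2}
    (fun f x => exist _ (op A f (fun i => (sval (x i)).1),
                         op A f (fun i => (sval (x i)).2))
       (con_op (fun i => svalP (x i))))
    (let: inhabits a := carrier_inhabited A in
     inhabits (exist _ (a, a) (con_refl beta a))).

Definition mkpair (x y : A) (h : beta x y) : pair_alg := exist _ (x, y) h.
Definition diag (x : A) : pair_alg := mkpair (con_refl beta x).

Lemma pair_ext (p q : pair_alg) :
  (sval p).1 = (sval q).1 -> (sval p).2 = (sval q).2 -> p = q.
Proof.
case: p q => [[x y] xy] [[x' y'] xy'] /= h1 h2; subst x' y'.
exact: eq_exist.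
Qed.

Lemma fst_hom : is_hom (fun p : pair_alg => (sval p).1).
Proof. by []. Qed.

Lemma snd_hom : is_hom (fun p : pair_alg => (sval p).2).
Proof. by []. Qed.

Lemma diag_hom : is_hom diag.
Proof. by move=> f x; exact: pair_ext. Qed.

Lemma in_variety_pair (V : variety S) :
  in_variety V A -> in_variety V pair_alg.
Proof.
move=> hA; apply: (in_variety_separated hA) => p q pq.
by apply: pair_ext; [exact: (pq _ fst_hom)|exact: (pq _ snd_hom)].
Qed.

Definition diag_syn (delta : con A) : con pair_alg :=
  syn (fun p : pair_alg => delta (sval p).1 (sval p).2).

Lemma diag_syn_saturates (delta : con A) (p q : pair_alg) :
  diag_syn delta p q -> delta (sval p).1 (sval p).2 ->
  delta (sval q).1 (sval q).2.
Proof. exact: syn_saturates. Qed.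

(** Coordinatewise [delta]-equivalence is a congruence of the pair algebra saturating the
    [delta]-related pairs, so it lies below the largest one. *)
Lemma diag_syn_modulo (delta : con A) (p q : pair_alg) :
  delta (sval p).1 (sval q).1 -> delta (sval p).2 (sval q).2 ->
  diag_syn delta p q.
Proof.
move=> h1 h2.
suff /con_leP : (Order.meet (preim_con fst_hom delta)
    (preim_con snd_hom delta) <= diag_syn delta)%O.
  by apply; exact/con_meetE.
apply: le_syn => {h1 h2} {}p {}q /con_meetE[/= h1 h2] pp.
by apply: con_trans h2; apply: con_trans pp; exact: con_sym.
Qed.

Definition centralizer (delta : con A) : con A :=
  preim_con diag_hom (diag_syn delta).

(** Left to right, the term condition is used with a single variable on the [alpha] side and the
    pairs of [beta] as parameters. Right to left, [diag_syn] being a congruence allows all the [a i]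
    to be exchanged at once. *)
Lemma centralizesP (alpha delta : con A) :
  centralizes alpha beta delta <-> (alpha <= centralizer delta)%O.
Proof.
split=> [C|/con_leP le m n t a b u v ab uv].
  apply/con_leP => a b ab n t c.
  have E z : ((sval (eval (sum_env (fun=> diag z) c) t)).1
        = eval (sum_env (fun=> z) (fun i => (sval (c i)).1)) t) *
      ((sval (eval (sum_env (fun=> diag z) c) t)).2
        = eval (sum_env (fun=> z) (fun i => (sval (c i)).2)) t).
    rewrite (hom_eval _ _ fst_hom) (hom_eval _ _ snd_hom).
    by split; congr eval; apply/funext => -[].
  rewrite !E; split; apply: C => i //;
    first [exact: (svalP (c i))|exact: con_sym].
pose c i : pair_alg := mkpair (uv i).
have E z : ((sval (eval (sum_env (fun i => diag (z i)) c) t)).1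
      = eval (sum_env z u) t) *
    ((sval (eval (sum_env (fun i => diag (z i)) c) t)).2
      = eval (sum_env z v) t).
  rewrite (hom_eval _ _ fst_hom) (hom_eval _ _ snd_hom).
  by split; congr eval; apply/funext => -[].
rewrite -!E; apply: diag_syn_saturates; apply: con_eval => -[i|j].
  exact: (le _ _ (ab i)).
exact: con_refl.
Qed.

End PairAlgebra.

(** * Elementary properties of centrality *)

Section Centrality.
Variables (S : signature) (A : algebra S).
Implicit Types alpha beta gamma delta : con A.

Lemma centralizes_mono alpha alpha' beta beta' delta :
  (alpha' <= alpha)%O -> (beta' <= beta)%O ->
  centralizes alpha beta delta -> centralizes alpha' beta' delta.
Proof.
move=> /con_leP aa /con_leP bb C m n t a b u v ab uv.
by apply: C => i; [exact: aa|exact: bb].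
Qed.

Lemma centralizes_left alpha beta : centralizes alpha beta alpha.
Proof.
move=> m n t a b u v ab uv h.
have E w : alpha (eval (sum_env a w) t) (eval (sum_env b w) t).
  by apply: con_eval => -[i|j] //=; exact: con_refl.
by apply: con_trans (E v); apply: con_trans h; exact: con_sym.
Qed.

Lemma centralizes_right alpha beta : centralizes alpha beta beta.
Proof.
move=> m n t a b u v ab uv _; apply: con_eval => -[i|j] //=; exact: con_refl.
Qed.

Lemma centralizes_sup (C : set (con A)) beta delta :
  (forall alpha, C alpha -> centralizes alpha beta delta) ->
  centralizes (con_sup C) beta delta.
Proof.
move=> h; apply/centralizesP/con_supP => alpha Ca.
exact/centralizesP/h.
Qed.

Lemma commutator_le_centralizes alpha beta delta :
  centralizes alpha beta delta -> (commutator alpha beta <= delta)%O.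
Proof. exact: (commutator_least alpha beta).2. Qed.

Lemma commutator_lel alpha beta : (commutator alpha beta <= alpha)%O.
Proof. exact/commutator_le_centralizes/centralizes_left. Qed.

Lemma commutator_ler alpha beta : (commutator alpha beta <= beta)%O.
Proof. exact/commutator_le_centralizes/centralizes_right. Qed.

(* (x,x) is Delta-related to (y,y), which shares its second coordinate with
   (x,y); as (x,x) and (x,y) share the first one, distributivity gives
   (x,x) Delta (x,y). *)
Lemma distributive_abelian (V : variety S) gamma delta :
  congruence_distributive V -> in_variety V A ->
  centralizes gamma gamma delta -> (gamma <= delta)%O.
Proof.
move=> hD hA /centralizesP/con_leP C; apply/con_leP => x y xy.
pose Delta := diag_syn gamma delta.
pose e0 := preim_con (@fst_hom _ _ gamma) delta.
pose e1 := preim_con (@snd_hom _ _ gamma) delta.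
suff D : Delta (diag gamma x) (mkpair xy).
  by apply: (diag_syn_saturates D); exact: con_refl.
have dist := hD _ (@in_variety_pair _ _ gamma _ hA) e0 Delta e1 I I I.
suff /con_leP : (Order.meet e0 (Order.join Delta e1) <= Delta)%O.
  apply; apply/con_meetE; split; first exact: con_refl.
  apply: (@con_trans _ _ _ _ (diag gamma y)).
    by have /con_leP := leUl Delta e1; apply; exact: C.
  have /con_leP := leUr e1 Delta; apply; exact: con_refl.
rewrite dist leUx leIr /=; apply/con_leP => p q /con_meetE[].
exact: diag_syn_modulo.
Qed.

End Centrality.

(** * Day's criterion from modularity *)

Section DayTerms.
Variables (S : signature) (A : algebra S).

Definition env4 (a b c d : A) (x : bool * bool) : A :=
  match x with
  | (false, false) => a | (false, true) => b
  | (true, false) => c | (true, true) => d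
  end.

Definition day_term (m : term S (bool * bool)) : Prop :=
  forall x y : A, eval (env4 x y y x) m = x.

Let E4 := bool * bool -> A.

Lemma term_fun_op (f : symb S)
    (g : 'I_(arity f) -> {g : E4 -> A | exists t, g = fun e => eval e t}) :
  exists t, (fun e => op A f (fun i => sval (g i) e)) = fun e => eval e t.
Proof.
have /choice[t ht] i : exists t, sval (g i) = fun e => eval e t.
  exact: (svalP (g i)).
exists (App f t); apply/funext => e /=; congr op; apply/funext => i.
by rewrite ht.
Qed.

(** The free algebra on four generators in the variety generated by [A], realised by term functions;
    the generators are the projections, indexed by [bool * bool]. *)
Definition term_fun_alg : algebra S :=
  @Algebra S {g : E4 -> A | exists t, g = fun e => eval e t}
    (fun f g => exist _ _ (term_fun_op g))
    (inhabits (exist _ _ (ex_intro _ (Var (false, false)) erefl))).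

Lemma in_variety_term_fun (V : variety S) :
  in_variety V A -> in_variety V term_fun_alg.
Proof.
move=> hA; apply: (in_variety_separated hA) => g h gh.
suff : sval g = sval h by case: g h {gh} => [g hg] [h hh] /=; exact: eq_exist.
by apply/funext => e; exact: (gh (fun k : term_fun_alg => sval k e)).
Qed.

Program Definition agree_con (E : set E4) : con term_fun_alg :=
  @Con _ _ (fun g h => forall e, E e -> sval g e = sval h e) _ _ _ _.
Next Obligation. by rewrite H. Qed.
Next Obligation. by rewrite H ?H0. Qed.
Next Obligation.
by rewrite /=; congr op; apply/funext => i; exact: H.
Qed.

(** With p1, ..., p4 the projections, p1 [th1] p2 [th2] p3 [th1] p4 and p1 [th3] p4. As
    [th2 <= th3], modularity places (p1,p4) in [th2] joined with the meet of [th1] and [th3]. Both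
    of these congruences saturate [P], which holds at p1, and at p4 it yields the claim. *)
Lemma day (V : variety S) (gamma : con A) (a b c d : A) :
  congruence_modular V -> in_variety V A -> gamma b d ->
  (forall m, day_term m ->
     gamma (eval (env4 a a c c) m) (eval (env4 a b d c) m)) ->
  gamma a c.
Proof.
move=> hM hA bd H.
pose proj x : term_fun_alg := exist _ _ (ex_intro _ (Var x) erefl).
pose th1 := agree_con [set e | exists x z, e = env4 x x z z].
pose th2 := agree_con [set e | exists x y z, e = env4 x y y z].
pose th3 := agree_con [set e | exists x y, e = env4 x y y x].
pose P (g : term_fun_alg) := (forall x y, sval g (env4 x y y x) = x)
  /\ gamma a (sval g (env4 a b d c)).
have sat3 g h : th3 g h -> P g -> forall x y, sval h (env4 x y y x) = x.
  by move=> gh [g1 _] x y; rewrite -gh ?g1//; exists x, y.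
have le23 : (th2 <= th3)%O.
  by apply/con_leP => g h gh e [x [y ->]]; apply: gh; exists x, y, x.
have term g e e' : (forall x, gamma (e x) (e' x)) ->
    gamma (sval (g : term_fun_alg) e) (sval g e').
  by have [t ->] := svalP g; exact: con_eval.
have sat2 g h : th2 g h -> P g -> P h.
  move=> gh Pg; split.
    by apply: sat3 Pg; have /con_leP := le23; exact.
  (* [gamma b d] moves the point (a,b,d,c) to (a,b,b,c), where [th2] forces [g] and [h] to agree,
     and then back. *)
  apply: con_trans Pg.2 _; apply: (@con_trans _ _ _ _ (sval g (env4 a b b c))).
    by apply: term => -[[] []] /=; first [exact: con_refl|exact: con_sym].
  rewrite gh; last by exists a, b, c.
  by apply: term => -[[] []] //=; exact: con_refl.
have day_P g : (forall x y, sval g (env4 x y y x) = x) ->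
    gamma (sval (g : term_fun_alg) (env4 a a c c)) (sval g (env4 a b d c)).
  by have [t ->] := svalP g; exact: H.
have sat13 g h : Order.meet th1 th3 g h -> P g -> P h.
  move=> /con_meetE[gh1 gh3] Pg.
  have h1 := sat3 _ _ gh3 Pg; split=> //.
  (* The hypothesis on Day terms, applied to [g] and to [h], replaces (a,b,d,c) by (a,a,c,c), where
     [th1] forces agreement. *)
  apply: con_trans (day_P _ h1); rewrite -gh1; last by exists a, c.
  apply: con_trans Pg.2 _; apply: con_sym; apply: day_P; exact: Pg.1.
have le : (Order.join th2 (Order.meet th1 th3) <= syn P)%O.
  by rewrite leUx; apply/andP; split; apply: le_syn.
suff : P (proj (true, true)) by case.
apply: (@syn_saturates _ _ _ (proj (false, false))); last first.
  by split=> //; exact: con_refl.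
have /con_leP := le; apply.
rewrite (hM _ (in_variety_term_fun hA)) //; apply/con_meetE; split; last first.
  by move=> _ [x [y ->]].
have J1 := con_leP _ _ (leUr th1 th2); have J2 := con_leP _ _ (leUl th2 th1).
apply: (@con_trans _ _ _ _ (proj (false, true))).
  by apply: J1 => _ [x [z ->]].
apply: (@con_trans _ _ _ _ (proj (true, false))).
  by apply: J2 => _ [x [y [z ->]]].
by apply: J1 => _ [x [z ->]].
Qed.

End DayTerms.

(** * Symmetry, monotonicity and additivity of the modular commutator *)

Section ModularCommutator.
Variables (S : signature) (V : variety S) (A : algebra S).
Hypotheses (hV : congruence_modular V) (hA : in_variety V A).
Implicit Types alpha beta gamma delta : con A.

(* Monotone in delta, and implied by centralization in one order while
   implying it in the other one: hence centralization is symmetric and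
   monotone in the modulus. *)
Definition day_condition alpha beta delta : Prop :=
  forall (m n : nat) (t : term S ('I_m + 'I_n))
    (u v : 'I_m -> A) (a b : 'I_n -> A),
    (forall i, beta (u i) (v i)) -> (forall j, alpha (a j) (b j)) ->
    forall d, day_term A d ->
    let M (x : 'I_m -> A) (y : 'I_n -> A) := eval (sum_env x y) t in
    delta (eval (env4 (M u a) (M u a) (M u b) (M u b)) d)
          (eval (env4 (M u a) (M v a) (M v b) (M u b)) d).

Lemma centralizes_day alpha beta delta :
  centralizes alpha beta delta -> day_condition alpha beta delta.
Proof.
move=> /centralizesP/con_leP C m n t u v a b uv ab d hd M.
pose row (z : 'I_n -> A) : pair_alg beta :=
  eval (sum_env (fun i => mkpair (uv i)) (fun j => diag beta (z j))) t.
have rowE z : ((sval (row z)).1 = M u z) * ((sval (row z)).2 = M v z).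
  rewrite (hom_eval _ _ (@fst_hom _ _ beta)).
  rewrite (hom_eval _ _ (@snd_hom _ _ beta)).
  by split; congr eval; apply/funext => -[].
have ruv : diag_syn beta delta (row a) (row b).
  apply: con_eval => -[i|j]; first exact: con_refl.
  exact: (C _ _ (ab j)).
have dM : diag_syn beta delta (diag beta (M u a)) (diag beta (M u b)).
  apply: C; apply: con_eval => -[i|j] //=; exact: con_refl.
(* At [z = a] the Day identity turns both coordinates of [eval (e z) d] into [M u a], so that this
   pair is [delta]-related; passing from [a] to [b] stays within one class of [diag_syn]. *)
pose e (z : 'I_n -> A) : bool * bool -> pair_alg beta :=
  env4 (diag beta (M u a)) (row a) (row z) (diag beta (M u z)).
have E z : ((sval (eval (e z) d)).1
      = eval (env4 (M u a) (M u a) (M u z) (M u z)) d) *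
    ((sval (eval (e z) d)).2
      = eval (env4 (M u a) (M v a) (M v z) (M u z)) d).
  rewrite (hom_eval _ _ (@fst_hom _ _ beta)).
  rewrite (hom_eval _ _ (@snd_hom _ _ beta)).
  by split; congr eval; apply/funext => -[[] []] /=; rewrite ?rowE.
rewrite -!E; apply: (@diag_syn_saturates _ _ _ _ (eval (e a) d)).
  by apply: con_eval => -[[] []]; first [exact: ruv|exact: dM|exact: con_refl].
rewrite !E !hd; exact: con_refl.
Qed.

(** Day's criterion is applied with [M u a], [M u b] as the pair known to be related and [M v a],
    [M v b] as the pair to relate; this exchanges [u] and [v] in the condition. *)
Lemma day_centralizes alpha beta delta :
  day_condition alpha beta delta -> centralizes beta alpha delta.
Proof.
move=> X m n t u v a b uv ab h.
apply: (day hV hA h) => d hd; apply: X => // i; exact: con_sym.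
Qed.

Lemma centralizes_sym alpha beta delta :
  centralizes alpha beta delta -> centralizes beta alpha delta.
Proof. by move=> /centralizes_day/day_centralizes. Qed.

Lemma centralizes_le alpha beta delta delta' : (delta <= delta')%O ->
  centralizes alpha beta delta -> centralizes alpha beta delta'.
Proof.
move=> /con_leP dd /centralizes_sym/centralizes_day X.
apply: day_centralizes => m n t u v a b uv ab d hd M; apply: dd; exact: X.
Qed.

Lemma commutator_leP alpha beta delta :
  (commutator alpha beta <= delta)%O <-> centralizes alpha beta delta.
Proof.
split; last exact: commutator_le_centralizes.
by move=> le; apply: centralizes_le le (commutator_least alpha beta).1.
Qed.

Lemma commutatorC alpha beta : commutator alpha beta = commutator beta alpha.
Proof.
by apply: le_anti; apply/andP; split; apply/commutator_leP/centralizes_sym;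
  exact: (commutator_least _ _).1.
Qed.

Lemma commutator_monol alpha alpha' beta : (alpha <= alpha')%O ->
  (commutator alpha beta <= commutator alpha' beta)%O.
Proof.
move=> aa; apply/commutator_leP.
exact: centralizes_mono aa (lexx _) (commutator_least alpha' beta).1.
Qed.

Lemma commutator_sup_le (C : set (con A)) beta delta :
  (forall alpha, C alpha -> (commutator alpha beta <= delta)%O) ->
  (commutator (con_sup C) beta <= delta)%O.
Proof.
move=> h; apply/commutator_leP/centralizes_sup => alpha /h.
by move=> /commutator_leP.
Qed.

End ModularCommutator.

(** * Unions of chains and maximal congruences *)

Section ChainsOfCongruences.
Variables (S : signature) (A : algebra S).
Implicit Types (C : set (con A)) (phi psi theta : con A).

Definition chain C : Prop := C !=set0 /\ total_on C (fun x y => x <= y)%O.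

Lemma chain_seq_bound C (s : seq (con A)) :
  chain C -> (forall phi, phi \in s -> C phi) ->
  exists2 theta, C theta & forall phi, phi \in s -> (phi <= theta)%O.
Proof.
move=> [[c Cc] Ct]; elim: s => [|phi s IH] sC; first by exists c.
have [psi s_psi|theta Ctheta le] := IH.
  by apply: sC; rewrite inE s_psi orbT.
have Cphi : C phi by apply: sC; rewrite inE eqxx.
case: (Ct _ _ Cphi Ctheta) => h.
  exists theta => // psi; rewrite inE => /orP[/eqP->//|]; exact: le.
exists phi => // psi; rewrite inE => /orP[/eqP->//|/le p].
exact: le_trans p h.
Qed.

Lemma chain_bound C (n : nat) (g : 'I_n -> con A) :
  chain C -> (forall i, C (g i)) ->
  exists2 theta, C theta & forall i, (g i <= theta)%O.
Proof.
move=> Cc Cg; have [phi /codomP[i ->]//|theta Ct le] :=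
  @chain_seq_bound C (codom g) Cc.
by exists theta => // i; apply: le; exact: codom_f.
Qed.

Definition chain_rel C (x y : A) : Prop := exists2 theta, C theta & theta x y.

(** Operations are finitary, so the finitely many members of the chain that relate the arguments
    have a common upper bound in it. *)
Lemma chain_union C : chain C -> exists theta : con A,
  forall x y, theta x y <-> chain_rel C x y.
Proof.
move=> Cc.
have refl x : chain_rel C x x.
  by have [[c ?] _] := Cc; exists c => //; exact: con_refl.
have sym x y : chain_rel C x y -> chain_rel C y x.
  by move=> [c ? ?]; exists c => //; exact: con_sym.
have trans x y z : chain_rel C x y -> chain_rel C y z -> chain_rel C x z.
  move=> [c Cc1 xy] [c' Cc2 yz].
  case: (Cc.2 _ _ Cc1 Cc2) => /con_leP h.
    by exists c' => //; apply: con_trans yz; exact: h.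
  by exists c => //; apply: con_trans xy _; exact: h.
have cop (f : symb S) (x y : 'I_(arity f) -> A) :
    (forall i, chain_rel C (x i) (y i)) -> chain_rel C (op A f x) (op A f y).
  move=> xy.
  have /choice[g Hg] i : exists c, C c /\ c (x i) (y i).
    by have [c ? ?] := xy i; exists c.
  have [theta Ct le] := chain_bound Cc (fun i => (Hg i).1).
  exists theta => //; apply: con_op => i.
  by have /con_leP := le i; apply; exact: (Hg i).2.
by exists (Con refl sym trans cop).
Qed.

Lemma maximal_above (P : set (con A)) theta :
  P theta ->
  (forall C psi, chain C -> C `<=` P ->
     (forall x y, psi x y <-> chain_rel C x y) -> P psi) ->
  exists phi, [/\ P phi, (theta <= phi)%O
    & forall psi, P psi -> (phi <= psi)%O -> psi = phi].
Proof.
move=> Ptheta HP.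
pose T := {phi | P phi /\ (theta <= phi)%O}.
pose le (s t : T) := (sval s <= sval t)%O.
have [||||[phi [Pphi tphi]] max] := @Zorn T le.
- by move=> t; exact: lexx.
- by move=> r s t; exact: le_trans.
- move=> s t st ts.
  have : sval s = sval t by apply: le_anti; apply/andP; split.
  by case: s t {st ts} => [s hs] [t ht] /=; exact: eq_exist.
(* Zorn's lemma also asks for a bound of the empty chain; [theta] itself serves. *)
- move=> C Ct; have [[c Cc]|C0] := pselect (C !=set0); last first.
    exists (exist _ theta (conj Ptheta (lexx _))) => s Cs.
    by case: C0; exists s.
  pose C' := [set sval s | s in C].
  have C'c : chain C'.
    split; first by exists (sval c); exists c.
    by move=> _ _ [s Cs <-] [t Ct' <-]; exact: Ct.
  have [psi psiE] := chain_union C'c.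
  have Ppsi : P psi.
    apply: HP C'c _ psiE => _ [s _ <-]; exact: (svalP s).1.
  have le_psi s : C s -> (sval s <= psi)%O.
    by move=> Cs; apply/con_leP => x y xy; apply/psiE; exists (sval s) => //;
      exists s.
  exists (exist _ psi (conj Ppsi (le_trans (svalP c).2 (le_psi c Cc)))) => s.
  exact: le_psi.
exists phi; split=> // psi Ppsi phipsi.
have := max (exist _ psi (conj Ppsi (le_trans tphi phipsi))) phipsi.
by move=> /(congr1 sval).
Qed.

(** The common consequence of compactness of the top congruence and of semi-degeneracy from which
    maximal congruences are obtained. *)
Definition proper_chains : Prop := forall C, chain C -> ~ C \top%O ->
  ~ forall x y, chain_rel C x y.

Lemma compact_proper_chains :
  compact_congruence (\top%O : con A) -> proper_chains.
Proof.
move=> comp C Cc Ctop all_C.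
have [F [Ffin FC topF]] : exists F : set (con A),
    [/\ finite_set F, F `<=` C & (\top <= con_sup F)%O].
  apply: comp; apply/con_leP => x y _.
  have [c Cc' cxy] := all_C x y; move=> d /(_ _ Cc')/con_leP; exact.
have [s sE] := (finite_seqP F).1 Ffin; subst F.
have [phi|theta Ct le] := chain_seq_bound Cc (s := s); first exact: FC.
apply: Ctop; suff <- : theta = \top%O by [].
apply: le_anti; rewrite lex1 /=; apply: le_trans topF _.
by apply/con_supP => phi; exact: le.
Qed.

End ChainsOfCongruences.

Lemma neq_top (S : signature) (A : algebra S) (phi : con A) :
  phi <> \top%O -> exists x y, ~ phi x y.
Proof.
move=> phi1; apply: contrapT => h; apply: phi1; apply: le_anti.
rewrite lex1 /=; apply/con_leP => x y _; apply: contrapT => nxy.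
by apply: h; exists x, y.
Qed.

(** * Semi-degenerate varieties *)

Section SemiDegenerate.
Variables (S : signature) (V : variety S) (A : algebra S).
Hypotheses (hS : semi_degenerate V) (hA : in_variety V A).

(* Modulo the syntactic congruence on alpha, the diagonal collapses to a
   one-element subalgebra. *)
Lemma semi_degenerate_centre (alpha delta : con A) :
  centralizes \top%O alpha delta -> (alpha <= delta)%O.
Proof.
move=> /centralizesP/con_leP C; apply/con_leP => x y xy.
apply: contrapT => nxy.
have [B [h [hh hsurj hE]]] := quotient_algebra (diag_syn alpha delta).
have hB : in_variety V B.
  exact: in_variety_image hh hsurj (in_variety_pair hA).
apply: (hS hB).
  exists (h (diag alpha x)), (h (mkpair xy)) => /hE.
  move=> /diag_syn_saturates xy'; apply: nxy; apply: xy'; exact: con_refl.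
exists (h (diag alpha x)) => f z zx /=.
have -> : z = fun=> h (diag alpha x) by apply/funext.
rewrite -(hh f (fun=> diag alpha x)) -diag_hom; apply/hE.
exact: C.
Qed.

(* In a reduced product of copies of A along the chain the constants become
   equal, while a choice of unrelated pairs keeps it nontrivial. *)
Lemma semi_degenerate_proper_chains : proper_chains A.
Proof.
move=> C Cc Ctop all_C.
pose P := power A (con A).
(* The factors are indexed by all of Con(A), but [R] compares two families only at the members of
   [C] from some [theta] upwards. *)
pose R (f g : P) := exists2 theta, C theta &
  forall phi, C phi -> (theta <= phi)%O -> phi (f phi) (g phi).
have Rr f : R f f.
  by have [[c Cc'] _] := Cc; exists c => // phi _ _; exact: con_refl.
have Rs f g : R f g -> R g f.
  by move=> [c Cc' fg]; exists c => // phi ? ?; apply: con_sym; exact: fg.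
have bound c c' : C c -> C c' -> exists2 d, C d & (c <= d)%O /\ (c' <= d)%O.
  by move=> Cc1 Cc2; case: (Cc.2 _ _ Cc1 Cc2) => h; [exists c'|exists c].
have Rt f g k : R f g -> R g k -> R f k.
  move=> [c Cc1 fg] [c' Cc2 gk]; have [d Cd [cd c'd]] := bound _ _ Cc1 Cc2.
  exists d => // phi Cphi dphi.
  by apply: con_trans (fg _ Cphi _) (gk _ Cphi _); apply: le_trans dphi.
have Ro (f : symb S) (x y : 'I_(arity f) -> P) :
    (forall i, R (x i) (y i)) -> R (op P f x) (op P f y).
  move=> xy.
  have /choice[g Hg] i : exists c, C c /\ forall phi, C phi -> (c <= phi)%O ->
      phi (x i phi) (y i phi) by have [c ? ?] := xy i; exists c.
  have [theta Ct le] := chain_bound Cc (fun i => (Hg i).1).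
  exists theta => // phi Cphi tphi; apply: con_op => i.
  by apply: (Hg i).2 => //; exact: le_trans (le i) tphi.
have [B [h [hh hsurj hE]]] := quotient_algebra (Con Rr Rs Rt Ro).
have [x0] := carrier_inhabited A.
have cst x : h (fun=> x) = h (fun=> x0).
  apply/hE; have [c Cc' cx] := all_C x x0.
  by exists c => // phi _ /con_leP; exact.
have hB : in_variety V B.
  exact: in_variety_image hh hsurj (in_variety_power hA).
apply: (hS hB).
  have /choice[p Hp] (phi : con A) : exists p : A * A, C phi -> ~ phi p.1 p.2.
    have [Cphi|nC] := pselect (C phi); last by exists (x0, x0).
    have [|x [y xy]] := @neq_top _ _ phi; last by exists (x, y).
    by move=> E; apply: Ctop; rewrite -E.
  exists (h (fun phi => (p phi).1)), (h (fun phi => (p phi).2)) => /hE.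
  by move=> [c Cc' /(_ c Cc' (lexx _))]; exact: Hp.
exists (h (fun=> x0)) => f z zx /=.
have -> : z = fun=> h (fun=> x0) by apply/funext.
by rewrite -(hh f (fun=> fun=> x0)) -(cst (op A f (fun=> x0))).
Qed.

End SemiDegenerate.

(** * Sufficient conditions for the standing hypotheses *)

Section StandingHypotheses.
Variables (S : signature) (V : variety S) (A : algebra S).
Hypotheses (hV : congruence_modular V) (hA : in_variety V A).
Implicit Types alpha beta phi theta : con A.

(** Modulo [phi], both [phi] and [alpha] centralize [beta]; if [alpha] is not below [phi], their
    join is the top by maximality. Doing this on both sides makes the top centralize itself, so
    [1,1] = 1 falls below [phi]. *)
Lemma maximal_prime phi :
  commutator \top%O \top%O = \top%O :> con A -> phi <> \top%O ->
  (forall psi, psi <> \top%O -> (phi <= psi)%O -> psi = phi) ->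
  prime_congruence phi.
Proof.
move=> com1 phi1 max.
have top_left alpha beta : centralizes alpha beta phi -> ~ (alpha <= phi)%O ->
    centralizes \top%O beta phi.
  move=> /centralizesP Ca nle; apply/centralizesP.
  suff <- : Order.join phi alpha = \top%O.
    by rewrite leUx Ca andbT; apply/centralizesP; exact: centralizes_left.
  apply: contrapT => /max /(_ (leUl _ _)) E.
  by apply: nle; rewrite -E leUr.
split=> // alpha beta /(commutator_leP hV hA) Cab.
have [|na] := pselect (alpha <= phi)%O; first by left.
have [|nb] := pselect (beta <= phi)%O; first by right.
have /(top_left beta) /(_ nb) C11 : centralizes beta \top%O phi.
  by apply: (centralizes_sym hV hA); exact: top_left na.
case: phi1; apply: le_anti; rewrite lex1 /= -[X in (X <= _)%O]com1.
exact: commutator_le_centralizes.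
Qed.

Lemma rho_top : commutator \top%O \top%O = \top%O :> con A ->
  proper_chains A -> [set theta : con A | rho theta = \top%O] = [set \top%O].
Proof.
move=> com1 HC; apply/seteqP; split=> theta /=; last first.
  move=> ->; apply: le_anti; rewrite lex1 /=; apply/con_infP.
  by move=> phi [].
move=> rho1; apply: contrapT => theta1.
have [C psi Cc CP psiE E|phi [phi1 tphi max]] :=
    @maximal_above _ A [set phi | phi <> \top%O] theta theta1.
  by apply: (HC _ Cc); [move=> /CP|move=> x y; apply/psiE; rewrite E].
apply: (phi1); apply: le_anti; rewrite lex1 /= -[X in (X <= _)%O]rho1.
have /con_infP : (rho theta <= rho theta)%O by exact: lexx.
by apply; split=> //; exact: maximal_prime.
Qed.

Lemma semi_degenerate_standing :
  semiprime A -> semi_degenerate V -> standing_hypotheses A.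
Proof.
move=> sp hS.
have com1 alpha : commutator alpha \top%O = alpha.
  apply: le_anti; rewrite commutator_lel /=.
  apply: (semi_degenerate_centre hS hA); apply: (centralizes_sym hV hA).
  exact: (commutator_least _ _).1.
split=> //; apply: rho_top => //.
exact: semi_degenerate_proper_chains hS hA.
Qed.

Section Distributive.
Hypothesis hD : congruence_distributive V.

(** The meet of [alpha] and [beta] centralizes itself modulo their commutator, hence lies below it
    by [distributive_abelian]. *)
Lemma distributive_commutator alpha beta :
  commutator alpha beta = Order.meet alpha beta.
Proof.
apply: le_anti; rewrite lexI commutator_lel commutator_ler /=.
apply: (distributive_abelian hD hA).
by apply: centralizes_mono (commutator_least alpha beta).1;
  [exact: leIl|exact: leIr].
Qed.

(** A congruence maximal among those omitting a pair (x,y) is meet-prime by distributivity, hence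
    prime because the commutator is the meet. So every pair of distinct elements is omitted by some
    prime congruence. *)
Lemma distributive_semiprime : semiprime A.
Proof.
apply: le_anti; rewrite le0x andbT; apply/con_leP => x y rxy.
apply: contrapT => xy.
have [C psi Cc CP psiE /psiE[c /CP]//|phi [phixy _ max]] :=
  @maximal_above _ A [set phi : con A | ~ phi x y] _ xy.
apply: (phixy); apply: rxy; split; last exact: le0x.
split=> [E|alpha beta]; first by apply: phixy; rewrite E.
rewrite distributive_commutator => ab.
have join_xy alpha' : ~ (alpha' <= phi)%O -> Order.join phi alpha' x y.
  move=> nle; apply: contrapT => /max /(_ (leUl _ _)) E.
  by apply: nle; rewrite -E leUr.
have [|na] := pselect (alpha <= phi)%O; first by left.
have [|nb] := pselect (beta <= phi)%O; first by right.
case: phixy.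
have : Order.meet (Order.join phi alpha) (Order.join phi beta) x y.
  by apply/con_meetE; split; exact: join_xy.
suff /con_leP : (Order.meet (Order.join phi alpha) (Order.join phi beta)
  <= phi)%O by exact.
rewrite (hD hA I I I) leUx leIr /= meetC (hD hA I I I) leUx.
by rewrite leIr /= meetC.
Qed.

Lemma distributive_standing : proper_chains A -> standing_hypotheses A.
Proof.
have com1 alpha : commutator alpha \top%O = alpha.
  by rewrite distributive_commutator meetx1.
move=> HC; split=> //; first exact: distributive_semiprime.
by apply: rho_top => //; exact: com1.
Qed.

End Distributive.

End StandingHypotheses.

(** * Principal ideals and the embedding of L into Id(L) *)

Section PrincipalIdeals.
Variables (d : Order.disp_t) (L : tbLatticeType d).
Implicit Types (x y a b e : L) (U : set L).

Local Notation "x ∧ y" := (Order.meet x y) (at level 40).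
Local Notation "x ∨ y" := (Order.join x y) (at level 50).

Definition down e : set L := [set x | (x <= e)%O].

Lemma is_ideal_down e : is_ideal (down e).
Proof.
split=> [|x y xe ye|x y xy ye] /=; first exact: le0x.
  by rewrite /down /= leUx; apply/andP.
exact: le_trans xy ye.
Qed.

Definition idl e : ideal L := Ideal (is_ideal_down e).

Lemma principal_idealE e : principal_ideal e = down e.
Proof.
apply/seteqP; split=> x.
  by apply; split; [exact: is_ideal_down|move=> _ ->; exact: lexx].
by move=> xe J [[_ _ Jl] J1]; apply: Jl xe _; exact: J1.
Qed.

Lemma ideal_gen_downU a b : ideal_gen (down a `|` down b) = down (a ∨ b).
Proof.
apply/seteqP; split=> x.
  apply; split; first exact: is_ideal_down.
  move=> y [ya|yb]; first exact: le_trans ya (leUl _ _).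
  exact: le_trans yb (leUr _ _).
move=> xab J [[_ JU Jl] J1]; apply: Jl xab _; apply: JU; apply: J1.
  by left; exact: lexx.
by right; exact: lexx.
Qed.

Lemma down_inj : injective down.
Proof.
move=> a b E; apply: le_anti; apply/andP; split.
  by have : down a a by [exact: lexx]; rewrite E.
by have : down b b by [exact: lexx]; rewrite -E.
Qed.

Lemma down_top e : down e = [set: L] <-> e = \top%O.
Proof.
have down1 : down \top%O = [set: L].
  by apply/seteqP; split=> x //= _; exact: lex1.
by split=> [E|->//]; apply: down_inj; rewrite E.
Qed.

Lemma idl_le a b : (idl a <= idl b)%O = (a <= b)%O.
Proof.
apply/ideal_leP/idP => [h|ab x xa]; last exact: le_trans xa ab.
exact: (h a (lexx a)).
Qed.

Lemma idl_meet a b : Order.meet (idl a) (idl b) = idl (a ∧ b).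
Proof.
apply: ideal_ext; apply/seteqP; split=> x.
  by move=> [xa xb]; rewrite /= /down /= lexI; apply/andP.
by rewrite /= /down /= lexI => /andP.
Qed.

Lemma idl_join a b : Order.join (idl a) (idl b) = idl (a ∨ b).
Proof. by apply: ideal_ext; exact: ideal_gen_downU. Qed.

Lemma idl_bot : \bot%O = idl \bot%O.
Proof.
apply: ideal_ext; apply/seteqP; split=> x /=.
  by move=> ->; exact: lexx.
by rewrite /down /= lex0 => /eqP.
Qed.

Lemma idl_top : \top%O = idl \top%O.
Proof. by apply: ideal_ext; symmetry; apply/down_top. Qed.

End PrincipalIdeals.

(** * Annihilators and pseudocomplements through the commutator *)

(* com stands for the modular commutator of a semiprime algebra with
   [alpha, top] = alpha, and pc a for the pseudocomplement a*. *)
Section CommutatorLattice.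
Variables (d : Order.disp_t) (L : tbLatticeType d).
Variables (sup : set L -> L) (com : L -> L -> L).
Implicit Types (x y a b e f : L) (U : set L).
Hypothesis supP : forall U x, (sup U <= x)%O <-> ubound U x.
Hypothesis comC : forall x y, com x y = com y x.
Hypothesis com1 : forall x, com x \top%O = x.
Hypothesis com_lel : forall x y, (com x y <= x)%O.
Hypothesis com_sup : forall U y z,
  (forall x, U x -> (com x y <= z)%O) -> (com (sup U) y <= z)%O.
Hypothesis com_mono : forall x x' y, (x <= x')%O -> (com x y <= com x' y)%O.
Hypothesis com_semiprime : forall x y,
  com x y = \bot%O -> Order.meet x y = \bot%O.

Local Notation "x ∧ y" := (Order.meet x y) (at level 40).
Local Notation "x ∨ y" := (Order.join x y) (at level 50).
Local Notation "0" := (\bot%O : L).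
Local Notation "1" := (\top%O : L).

Lemma le_sup U x : U x -> (x <= sup U)%O.
Proof. by move=> Ux; have /supP := lexx (sup U); exact. Qed.

Lemma com_ler x y : (com x y <= y)%O.
Proof. by rewrite comC. Qed.

Lemma com_le_meet x y : (com x y <= x ∧ y)%O.
Proof. by rewrite lexI com_lel com_ler. Qed.

Lemma meet0_com x y : x ∧ y = 0 <-> com x y = 0.
Proof.
split; last exact: com_semiprime.
by move=> E; apply/eqP; rewrite -lex0 -E com_le_meet.
Qed.

Lemma meet0_le x x' y : (x <= x')%O -> x' ∧ y = 0 -> x ∧ y = 0.
Proof.
by move=> xx' E; apply/eqP; rewrite -lex0 -E leI2.
Qed.

Lemma com_joinl x y z : (com (x ∨ y) z <= com x z ∨ com y z)%O.
Proof.
apply: (@le_trans _ _ (com (sup [set x; y]) z)).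
  apply: com_mono; rewrite leUx.
  by apply/andP; split; apply: le_sup; [left|right].
by apply: com_sup => w [->|->]; [exact: leUl|exact: leUr].
Qed.

Definition pc a : L := sup (Ann a).

(** Disjointness is the vanishing of [com], and [com] is additive; thus the supremum of all elements
    disjoint from [a] is disjoint from [a], although [L] is not assumed distributive. *)
Lemma pcP x a : (x <= pc a)%O <-> x ∧ a = 0.
Proof.
split=> [xa|xa]; last exact: le_sup.
apply: meet0_le xa _; apply/meet0_com/eqP; rewrite -lex0.
by apply: com_sup => y /meet0_com ->.
Qed.

Lemma AnnE a : Ann a = down (pc a).
Proof. by apply/seteqP; split=> x /pcP. Qed.

Lemma AnnS_sup U : AnnS U = Ann (sup U).
Proof.
apply/seteqP; split=> x h; last first.
  move=> u Uu; rewrite /= /Ann /= meetC.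
  by apply: meet0_le (le_sup Uu) _; rewrite meetC.
rewrite /Ann /= meetC; apply/meet0_com/eqP; rewrite -lex0.
by apply: com_sup => u /h xu; rewrite lex0; apply/eqP/meet0_com; rewrite meetC.
Qed.

Lemma AnnS_down e : AnnS (down e) = Ann e.
Proof.
apply/seteqP; split=> x h; first by apply: h; exact: lexx.
by move=> u ue; rewrite /= /Ann /= meetC; apply: meet0_le ue _; rewrite meetC.
Qed.

Lemma AnnS_Ann a : AnnS (Ann a) = down (pc (pc a)).
Proof. by rewrite AnnE AnnS_down AnnE. Qed.

Lemma pc_meet a : pc a ∧ a = 0.
Proof. by apply/pcP; exact: lexx. Qed.

Lemma pc_anti a b : (a <= b)%O -> (pc b <= pc a)%O.
Proof.
move=> ab; apply/pcP; rewrite meetC; apply: meet0_le ab _.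
by rewrite meetC pc_meet.
Qed.

Lemma le_pcpc a : (a <= pc (pc a))%O.
Proof. by apply/pcP; rewrite meetC pc_meet. Qed.

Lemma pc_pcpc a : pc (pc (pc a)) = pc a.
Proof. by apply: le_anti; rewrite le_pcpc pc_anti ?le_pcpc. Qed.

Lemma pc0 : pc 0 = 1.
Proof. by apply: le_anti; rewrite lex1; apply/pcP; rewrite meetx0. Qed.

Lemma pcU a b : pc (a ∨ b) = pc a ∧ pc b.
Proof.
apply: le_anti; apply/andP; split.
  by rewrite lexI !pc_anti ?leUl ?leUr.
apply/pcP; rewrite meetC; apply/meet0_com/eqP; rewrite -lex0.
apply: (le_trans (com_joinl _ _ _)); rewrite leUx.
apply/andP; split; apply: (le_trans (com_le_meet _ _)); rewrite meetC.
  by rewrite -(pc_meet a) leI2 ?leIl.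
by rewrite -(pc_meet b) leI2 ?leIr.
Qed.

Lemma meet0_pcpc x a : x ∧ a = 0 -> x ∧ pc (pc a) = 0.
Proof. by move=> /pcP xa; apply: meet0_le xa _; rewrite meetC pc_meet. Qed.

Lemma pcpcI a b : pc (pc (a ∧ b)) = pc (pc a) ∧ pc (pc b).
Proof.
apply: le_anti; apply/andP; split.
  by rewrite lexI !pc_anti ?leIl ?leIr.
(* Disjointness from c implies disjointness from c**, so first a** and then b** may be replaced by
   [a] and [b]. *)
apply/pcP; rewrite meetC (meetC (pc (pc a))) meetA.
apply: meet0_pcpc; rewrite meetAC; apply: meet0_pcpc.
by rewrite -meetA pc_meet.
Qed.

(** * Complemented elements *)

Lemma complements_com e f x : complements e f -> x = com x e ∨ com x f.
Proof.
move=> [_ ef]; apply: le_anti; rewrite leUx !com_lel !andbT.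
by rewrite -{1}(com1 x) comC -ef (comC x e) (comC x f) com_joinl.
Qed.

Lemma complementsC e f : complements e f -> complements f e.
Proof. by move=> [h1 h2]; split; rewrite ?(meetC f) ?(joinC f). Qed.

(** Split the meet of [x] and [e] as [x ∧ e, e] v [x ∧ e, f]; the second part lies below e ∧ f = 0.
    Meeting with a complemented element is therefore additive, which makes B(L) Boolean. *)
Lemma complements_meet e f x : complements e f -> x ∧ e = com x e.
Proof.
move=> ef; apply: le_anti; rewrite com_le_meet andbT.
rewrite {1}(complements_com (x ∧ e) ef) leUx com_mono ?leIl //=.
apply: le_trans (le0x _); rewrite -ef.1; apply: le_trans (com_le_meet _ _) _.
by rewrite leI2 ?leIr.
Qed.

Lemma complements_pc e f : complements e f -> f = pc e.
Proof.
move=> ef; apply: le_anti; apply/andP; split.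
  by apply/pcP; rewrite meetC ef.1.
rewrite (complements_com (pc e) ef) -(complements_meet _ ef) pc_meet.
by rewrite leUx le0x com_ler.
Qed.

Lemma complemented_pcpc e : complemented L e -> pc (pc e) = e.
Proof.
move=> [f ef]; rewrite -(complements_pc ef).
by rewrite -(complements_pc (complementsC ef)).
Qed.

Lemma complemented_meetUr e x y :
  complemented L e -> e ∧ (x ∨ y) = (e ∧ x) ∨ (e ∧ y).
Proof.
move=> [f ef]; rewrite !(meetC e) !(complements_meet _ ef).
by apply: le_anti; rewrite com_joinl leUx !com_mono ?leUl ?leUr.
Qed.

Lemma complementsI e f e' f' : complements e f -> complements e' f' ->
  complements (e ∧ e') (f ∨ f').
Proof.
move=> ef ef'.
have Ce : complemented L e by exists f.
have Ce' : complemented L e' by exists f'.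
split.
  rewrite -meetA (complemented_meetUr _ _ Ce') ef'.1 joinx0 meetC -meetA.
  by rewrite (meetC f) ef.1 meetx0.
apply: le_anti; rewrite lex1 /= joinA -ef.2 leUx; apply/andP; split; last first.
  by apply: le_trans (leUl _ _); exact: leUr.
have {1}-> : e = (e ∧ e') ∨ (e ∧ f').
  by rewrite -complemented_meetUr // ef'.2 meetx1.
rewrite leUx -joinA leUl /=; apply: le_trans (leIr _ _) _.
by rewrite joinA leUr.
Qed.

Lemma complemented_boolean : boolean_sublattice (complemented L).
Proof.
split.
- split.
  + by exists 1; split; rewrite ?meetx1 ?joinx1.
  + by exists 0; split; rewrite ?meetx0 ?joinx0.
  + by move=> e e' [f ef] [f' ef']; exists (f ∨ f'); exact: complementsI.
  move=> e e' [f ef] [f' ef']; exists (f ∧ f'); apply: complementsC.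
  by apply: complementsI; exact: complementsC.
- by move=> x y z Cx _ _; exact: complemented_meetUr.
move=> e [f ef]; exists f => //; exists e; exact: complementsC.
Qed.

(** * Reduction of all the conditions to the Stone identity *)

Definition pc_join_top : Prop := forall a, pc a ∨ pc (pc a) = 1.

Lemma complemented_pcP a : complemented L (pc a) <-> pc a ∨ pc (pc a) = 1.
Proof.
split=> [[f ef]|E]; first by rewrite -(complements_pc ef) ef.2.
by exists (pc (pc a)); split=> //; rewrite meetC pc_meet.
Qed.

Lemma stoneP : stone L <-> pc_join_top.
Proof.
split=> [h a|h a].
  apply/complemented_pcP; have [e Ce] := h a; rewrite AnnE principal_idealE.
  by move=> /(@down_inj _ L) ->.
exists (pc a); first exact/complemented_pcP/h.
by rewrite AnnE principal_idealE.
Qed.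

Lemma cond_ivP : cond_iv L <-> pc_join_top.
Proof.
have E a b : Ann (a ∧ b) = ideal_gen (Ann a `|` Ann b) <->
    pc (a ∧ b) = pc a ∨ pc b.
  rewrite !AnnE ideal_gen_downU.
  by split=> [/(@down_inj _ L)|->].
split=> [h a|h a b].
  (* Taking b = a* makes the left side 0* = 1. *)
  by have /E := h a (pc a); rewrite (meetC a) pc_meet pc0.
apply/E/le_anti; apply/andP; split; last first.
  by rewrite leUx !pc_anti ?leIl ?leIr.
have split x c : (x <= pc c ∨ com x (pc (pc c)))%O.
  have Cc : complements (pc c) (pc (pc c)).
    by split; [rewrite meetC pc_meet|exact: h].
  by rewrite {1}(complements_com x Cc) leU2 // com_ler.
set x := pc (a ∧ b); set y := com x (pc (pc a)).
apply: (le_trans (split x a)); rewrite leUx leUl /= -/y.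
apply: (le_trans (split y b)); rewrite leUx leUr /=.
(* What remains, [y,b**], lies below (a ∧ b)*, a** and b**, and the meet of the last two is (a ∧
   b)**. *)
apply: le_trans (le0x _); rewrite -(pc_meet (pc (a ∧ b))) pcpcI.
rewrite meetC (meetC (pc (pc a))) meetA.
apply: (le_trans (com_le_meet _ _)); rewrite meetAC leI2 //.
by rewrite (le_trans (com_le_meet _ _)).
Qed.

(** Under the Stone identity c ↦ c** is a closure operator with values in B(L) that fixes B(L); it
    sends the supremum in [L] to the one in B(L). *)
Lemma complemented_sup U : pc_join_top -> U `<=` complemented L ->
  has_sup_in (complemented L) U.
Proof.
move=> h UC; exists (pc (pc (sup U))); split.
  split; first exact/complemented_pcP/h.
  by move=> x Ux; apply: le_trans (le_sup Ux) (le_pcpc _).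
move=> e [Ce Ue]; rewrite -(complemented_pcpc Ce).
by do 2!apply: pc_anti; exact/supP.
Qed.

(** The supremum in [L] of all lower bounds is closed under **; it stays below each member of [U]
    because these are fixed. *)
Lemma complemented_inf U : pc_join_top -> U `<=` complemented L ->
  has_inf_in (complemented L) U.
Proof.
move=> h UC; exists (pc (pc (sup (lbound U)))); split.
  split; first exact/complemented_pcP/h.
  move=> x Ux; rewrite -(complemented_pcpc (UC _ Ux)).
  by do 2!apply: pc_anti; apply/supP => y; exact.
by move=> e [_ Ue]; exact: le_trans (le_sup Ue) (le_pcpc _).
Qed.

Lemma complemented_complete s : pc_join_top ->
  complete_boolean_sublattice s (complemented L).
Proof.
move=> h; split; first exact: complemented_boolean.
by move=> U UC _; split; [exact: complemented_sup|exact: complemented_inf].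
Qed.

Section PrincipalDoubleAnnihilators.
Hypothesis h : pc_join_top.

(** This identifies [P2Ann L] with the image of B(L) under [idl], along which the Boolean structure
    and completeness are transported. *)
Lemma P2AnnP (I : ideal L) :
  P2Ann L I <-> exists2 e, complemented L e & I = idl e.
Proof.
split=> [[a _ E]|[e Ce ->]].
  exists (pc (pc a)); first exact/complemented_pcP/h.
  by apply: ideal_ext; rewrite -E AnnS_Ann.
by exists e => //; rewrite AnnS_Ann complemented_pcpc.
Qed.

Lemma P2Ann_boolean : boolean_sublattice [set I : ideal L | P2Ann L I].
Proof.
have [[C0 C1 CI CU] Cd Cc] := complemented_boolean.
split.
- split.
  + by apply/P2AnnP; exists 0 => //; exact: idl_bot.
  + by apply/P2AnnP; exists 1 => //; exact: idl_top.
  + move=> _ _ /P2AnnP[e Ce ->] /P2AnnP[f Cf ->]; apply/P2AnnP.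
    by exists (e ∧ f); [exact: CI|exact: idl_meet].
  move=> _ _ /P2AnnP[e Ce ->] /P2AnnP[f Cf ->]; apply/P2AnnP.
  by exists (e ∨ f); [exact: CU|exact: idl_join].
- move=> _ _ _ /P2AnnP[e Ce ->] /P2AnnP[f Cf ->] /P2AnnP[g Cg ->].
  by rewrite !(idl_join, idl_meet) Cd.
move=> _ /P2AnnP[e Ce ->]; have [f Cf [ef0 ef1]] := Cc e Ce.
exists (idl f); first by apply/P2AnnP; exists f.
by split; rewrite ?idl_meet ?idl_join ?ef0 ?ef1 ?idl_bot ?idl_top.
Qed.

Lemma P2Ann_complete s :
  complete_boolean_sublattice s [set I : ideal L | P2Ann L I].
Proof.
split; first exact: P2Ann_boolean.
move=> U UP _; pose U' := [set e | complemented L e /\ U (idl e)].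
have U'C : U' `<=` complemented L by move=> e [].
split.
  have [e [[Ce ub_e] least_e]] := complemented_sup h U'C.
  exists (idl e); split; first split.
  - by apply/P2AnnP; exists e.
  - move=> I UI; have /P2AnnP[f Cf E] := UP _ UI; rewrite E idl_le.
    by apply: ub_e; split=> //; rewrite -E.
  move=> _ [/P2AnnP[f Cf ->] ub_f]; rewrite idl_le; apply: least_e.
  by split=> // g [_ /ub_f]; rewrite idl_le.
have [e [[Ce lb_e] max_e]] := complemented_inf h U'C.
exists (idl e); split; first split.
- by apply/P2AnnP; exists e.
- move=> I UI; have /P2AnnP[f Cf E] := UP _ UI; rewrite E idl_le.
  by apply: lb_e; split=> //; rewrite -E.
move=> _ [/P2AnnP[f Cf ->] lb_f]; rewrite idl_le; apply: max_e.
by split=> // g [_ /lb_f]; rewrite idl_le.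
Qed.

Lemma pc_join_top_cond3 s : cond3 L s.
Proof.
exists (fun a => idl (pc (pc a))); split.
- by move=> a; rewrite AnnS_Ann.
- exact: P2Ann_complete.
- by move=> a b; rewrite idl_meet pcpcI.
move=> a b; rewrite idl_join; congr idl.
have /cond_ivP /(_ (pc a) (pc b)) := h.
rewrite !AnnE ideal_gen_downU => /(@down_inj _ L) <-.
by rewrite pcU.
Qed.

End PrincipalDoubleAnnihilators.

Lemma cond3_pc_join_top s : cond3 L s -> pc_join_top.
Proof.
move=> [f [fE _ _ fU]] a.
have fidl b : f b = idl (pc (pc b)).
  by apply: ideal_ext; rewrite fE AnnS_Ann.
have := fU a (pc a); rewrite !fidl idl_join pcU meetC pc_meet pc0 pc_pcpc.
rewrite joinC -idl_top => E; apply/down_top.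
by have /= -> := congr1 (@ideal_set _ L) E.
Qed.

Lemma join_AnnP U : ideal_gen (AnnS U `|` AnnS (AnnS U)) = [set: L] <->
  pc (sup U) ∨ pc (pc (sup U)) = 1.
Proof. by rewrite AnnS_sup AnnS_Ann AnnE ideal_gen_downU down_top. Qed.

Lemma AnnS1 a : AnnS [set a] = Ann a.
Proof. exact: bigcap_set1. Qed.

Lemma sup1 a : sup [set a] = a.
Proof.
apply: le_anti; rewrite le_sup // andbT; apply/supP => x ->; exact: lexx.
Qed.

(** Conditions 1 and 5 are tested on singletons to get the Stone identity. Conversely, the identity
    gives every condition for arbitrary [U], since [AnnS U] is the annihilator of one element,
    [sup U]. *)
Lemma condP (i : cond_index) (s : smallness) :
  (forall a : L, small s [set a]) -> cond L i s <-> pc_join_top.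
Proof.
move=> s1; case: i => /=.
- split=> [H|/stoneP H U _]; last by rewrite AnnS_sup; exact: H.
  by apply/stoneP => a; rewrite -AnnS1; exact: H.
- split=> [[/stoneP]//|H]; split; first exact/stoneP.
  exact: complemented_complete.
- by split=> [|H]; [exact: cond3_pc_join_top|exact: pc_join_top_cond3].
- split=> [[/cond_ivP]//|H]; split; first exact/cond_ivP.
  move=> U _; exists (pc (sup U)) => //.
  by rewrite (AnnS_sup U) AnnS_Ann AnnE.
split=> [H a|H U _]; last exact/join_AnnP.
by rewrite -(sup1 a); exact/join_AnnP/H.
Qed.

Lemma stone_equivalences :
  [/\ forall i s, (forall a : L, small s [set a]) -> cond L i s <-> stone L,
      cond_iv L <-> stone L,
      stone L -> strongly_stone L /\
        complete_boolean_sublattice SAll (complemented L)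
    & (forall a, ideal_gen (Ann a `|` AnnS (Ann a)) = [set: L]) <-> stone L].
Proof.
have -> : stone L = pc_join_top by apply/propext; exact: stoneP.
split=> [|||].
- exact: condP.
- exact: cond_ivP.
- move=> H; split; last exact: complemented_complete.
  by move=> U; exact: (condP I1 (s := SAll) (fun=> I)).2 H U I.
split=> H a; first by rewrite -(sup1 a); apply/join_AnnP; rewrite AnnS1.
by rewrite -AnnS1; exact/join_AnnP.
Qed.

End CommutatorLattice.

(** * Application to the congruence lattice *)

Lemma small_set1 (T K : Type) (a : T) :
  inhabited K -> small (AtMost K) [set a].
Proof.
by move=> [k]; rewrite /= (card_le_eql (eq_card1 a k)) card_leT.
Qed.

(** Every prime congruence contains [alpha] or [beta], hence their meet, and the primes intersect in
    the bottom congruence. *)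
Lemma semiprime_meet (S : signature) (A : algebra S) (alpha beta : con A) :
  semiprime A -> commutator alpha beta = \bot%O ->
  Order.meet alpha beta = \bot%O.
Proof.
move=> sp ab0; apply: le_anti; rewrite le0x andbT -[X in (_ <= X)%O]sp.
apply/con_infP => phi [[_ primephi] _].
have [] := primephi alpha beta; first by rewrite ab0 le0x.
  by apply: le_trans; exact: leIl.
by apply: le_trans; exact: leIr.
Qed.

Theorem corollary7p7 (S : signature) (V : variety S) (A : algebra S)
    (hV : congruence_modular V) (hA : in_variety V A) :
  [/\ (semiprime A -> semi_degenerate V -> standing_hypotheses A),
      (congruence_distributive V -> compact_congruence (\top%O : con A) ->
        standing_hypotheses A)
    & (congruence_distributive V -> semi_degenerate V ->
        standing_hypotheses A)]
  /\
  (standing_hypotheses A ->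
    (forall (i j : cond_index) (K M : Type), inhabited K -> inhabited M ->
      [/\ cond_iv (con A) <-> cond (con A) i (AtMost K),
          cond (con A) i (AtMost K) <-> cond (con A) j (AtMost M),
          cond_iv (con A) <-> cond (con A) i SFinite
        & cond_iv (con A) <-> cond (con A) i SAll])
    /\
    [<-> stone (con A);
         strongly_stone (con A) /\
           complete_boolean_sublattice SAll (complemented (con A));
         cond3 (con A) SFinite;
         cond3 (con A) SAll;
         cond_iv (con A);
         forall a : con A,
           ideal_gen (Ann a `|` AnnS (Ann a)) = [set: con A]]).
Proof.
split.
  split=> [|hD comp|hD hS].
  - exact: semi_degenerate_standing hV hA.
  - exact: (distributive_standing hV hA hD (compact_proper_chains comp)).
  exact: (distributive_standing hV hA hD (semi_degenerate_proper_chains hS hA)).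
move=> [sp _ com1].
have [condE ivE strong annE] := @stone_equivalences _ (con A) (@con_sup _ A)
  (@commutator _ A) (@con_supP _ A) (commutatorC hV hA) com1
  (@commutator_lel _ A) (commutator_sup_le hV hA)
  (commutator_monol hV hA) (fun alpha beta => semiprime_meet sp).
have K1 K : inhabited K -> forall a : con A, small (AtMost K) [set a].
  by move=> hK a; exact: small_set1.
have F1 (a : con A) : small SFinite [set a] by exact: finite_set1.
have A1 (a : con A) : small SAll [set a] by [].
split=> [i j K M /K1 hK /K1 hM|].
  rewrite (propext ivE) (propext (condE i _ hK)) (propext (condE j _ hM)).
  by rewrite (propext (condE i _ F1)) (propext (condE i _ A1)).
tfae.
- exact: strong.
(* Being strongly Stone is condition 1 for arbitrary subsets. *)
- by move=> [st _]; apply/(condE I3 SFinite F1)/(condE I1 SAll A1) => U _.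
- by move/(condE I3 SFinite F1)/(condE I3 SAll A1).
- by move/(condE I3 SAll A1)/ivE.
- by move/ivE/annE.
by move/annE.
Qed.
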